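(* For every natural number $n \in \mathbb{N} = \{1, 2, 3, \ldots\}$, the binary complexity $\| n \|_{2}$ satisfies $$\log_{2}(n) \leq \| n \|_{2}.$$
   Context: For a fixed natural number $m$, the $m$-ary complexity $\| n \|_{m}$ of a natural number $n \geq 1$ is the smallest number of possibly repeated selections from $\{1, 2, \ldots, m\}$ (counted with repetition) that can be used to express $n$ using any combination of addition, multiplication and bracket symbols, with the brackets forming legal nestings. Thus an admissible expression is either a single constant from $\{1, 2, \ldots, m\}$, or of the form $(E + F)$ or $(E \times F)$ with $E$ and $F$ admissible expressions; $\| n \|_{m}$ is the minimum, over all admissible expressions whose value is $n$, of the total number of occurrences of constants in the expression. The binary complexity $\| n \|_{2}$ is the case $m = 2$, in which the allowed constants are $1$ and $2$. For example, $\| 1 \|_{2} = \| 2 \|_{2} = 1$ and $\| 3 \|_{2} = 2$. Here $\log_{2}$ denotes the base-$2$ logarithm. *)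

(* Defs.v *)
(* Stdlib world: classical reals and Hilbert epsilon *)
From Stdlib Require Import Reals Arith Lia Classical ClassicalEpsilon.

Inductive expr (m : nat) : Type :=
| Const (c : nat) (hc : 1 <= c <= m)
| Plus (E F : expr m)
| Times (E F : expr m).

Arguments Const {m} c hc.
Arguments Plus {m} E F.
Arguments Times {m} E F.

Fixpoint value {m : nat} (E : expr m) : nat :=
  match E with
  | Const c _ => c
  | Plus E F => value E + value F
  | Times E F => value E * value F
  end.

Fixpoint num_consts {m : nat} (E : expr m) : nat :=
  match E with
  | Const _ _ => 1
  | Plus E F => num_consts E + num_consts F
  | Times E F => num_consts E + num_consts F
  end.

Definition is_complexity (m n k : nat) : Prop :=
  (exists E : expr m, value E = n /\ num_consts E = k) /\
  (forall E : expr m, value E = n -> k <= num_consts E).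

(* The complexity is the unique [k] satisfying [is_complexity m n k] when
   [1 <= m] and [1 <= n] (see [complexity_spec] and [is_complexity_unique]);
   it is an unspecified number when [m = 0] or [n = 0], where no expression
   has value [n]. *)
Definition complexity (m n : nat) : nat :=
  epsilon (inhabits 0) (is_complexity m n).

Lemma expr_exists (m n : nat) : 1 <= m -> 1 <= n ->
  exists E : expr m, value E = n.
Proof.
  intros hm hn. induction n as [|n IH]; [lia|].
  destruct (Nat.eq_dec n 0) as [->|hn0].
  - exists (Const 1 (conj (le_n 1) hm)). reflexivity.
  - destruct IH as [E hE]; [lia|].
    exists (Plus E (Const 1 (conj (le_n 1) hm))). simpl. lia.
Qed.

Lemma is_complexity_exists (m n : nat) (E : expr m) : value E = n ->
  exists k, is_complexity m n k.
Proof.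
  remember (num_consts E) as s eqn:hs. revert E hs.
  induction s as [s IH] using lt_wf_ind. intros E hs hE.
  destruct (classic (exists F : expr m, value F = n /\ num_consts F < s))
    as [[F [hF hlt]]|hno].
  - exact (IH (num_consts F) hlt F eq_refl hF).
  - exists s. split; [exists E; auto|].
    intros F hF. destruct (le_lt_dec s (num_consts F)) as [h|h]; [exact h|].
    exfalso. apply hno. exists F. auto.
Qed.

Lemma is_complexity_unique (m n k l : nat) :
  is_complexity m n k -> is_complexity m n l -> k = l.
Proof.
  intros [[E [hE <-]] h1] [[F [hF <-]] h2].
  apply Nat.le_antisymm; auto.
Qed.

Lemma complexity_spec (m n : nat) : 1 <= m -> 1 <= n ->
  is_complexity m n (complexity m n).
Proof.
  intros hm hn. unfold complexity. apply epsilon_spec.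
  destruct (expr_exists m n hm hn) as [E hE].
  exact (is_complexity_exists m n E hE).
Qed.

(* Main.v *)
Require Import Defs.
From Stdlib Require Import Reals.
From Stdlib Require Import Lia Lra.
Open Scope R_scope.

(** For [m >= 2], an expression with [k] constants has value at most [m ^ k] ([value_le_pow]), by
    structural induction: bounds multiply under products, and a sum of two numbers that are at least
    2 never exceeds their product. Applying this with [m = 2] to an expression of minimal size for
    [n] and taking logarithms gives the theorem. *)

Lemma num_consts_pos {m : nat} (E : expr m) : (1 <= num_consts E)%nat.
Proof. induction E; simpl; lia. Qed.

Lemma value_le_pow {m : nat} (hm : (2 <= m)%nat) (E : expr m) :
  (value E <= m ^ num_consts E)%nat.
Proof.
  induction E as [c hc|E IHE F IHF|E IHE F IHF]; cbn [value num_consts].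
  - rewrite Nat.pow_1_r. lia.
  - rewrite Nat.pow_add_r.
    (* Both powers are at least 2, so their sum is at most their product. *)
    assert (hE : (m ^ 1 <= m ^ num_consts E)%nat)
      by (apply Nat.pow_le_mono_r; [lia | apply num_consts_pos]).
    assert (hF : (m ^ 1 <= m ^ num_consts F)%nat)
      by (apply Nat.pow_le_mono_r; [lia | apply num_consts_pos]).
    rewrite Nat.pow_1_r in hE, hF. nia.
  - rewrite Nat.pow_add_r. now apply Nat.mul_le_mono.
Qed.

Theorem theorem1 (n : nat) (hn : (1 <= n)%nat) :
  Rlog 2 (INR n) <= INR (complexity 2 n).
Proof.
  destruct (complexity_spec 2 n (le_S _ _ (le_n 1)) hn) as [[E [hv hk]] _].
  rewrite <- hk.
  assert (hle : INR n <= 2 ^ num_consts E).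
  { rewrite <- hv. change 2 with (INR 2). rewrite <- pow_INR.
    apply le_INR, value_le_pow, le_n. }
  assert (hn0 : 0 < INR n) by (apply lt_0_INR; lia).
  assert (hln2 : 0 < ln 2) by (rewrite <- ln_1; apply ln_increasing; lra).
  (* Clearing the denominator [ln 2] leaves [ln (INR n) <= ln (2 ^ num_consts E)], so monotonicity
     of [ln] applied to [hle] suffices. *)
  unfold Rlog. apply (Rmult_le_reg_r (ln 2)); [exact hln2|].
  unfold Rdiv. rewrite Rmult_assoc, Rinv_l, Rmult_1_r by lra.
  rewrite <- ln_pow by lra.
  destruct hle as [hlt | ->]; [left; now apply ln_increasing | apply Rle_refl].
Qed.
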